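(* Let $X$ be a closed definable subset of $\mathbb{R}^q$ and let $\mathcal{C}_1,\dots,\mathcal{C}_c$ be the connected components of the germ $(X,\infty)$. If each of $\mathcal{C}_1,\dots,\mathcal{C}_c$ is locally LNE at $\infty$ and $\mathcal{C}_i^\infty\cap\mathcal{C}_j^\infty=\emptyset$ for $1\le i<j\le c$, then the tangent cone $\widehat{X^\infty}^+$ of $X$ at $\infty$ is LNE in $\mathbb{R}^q$.
   Context: Fix an o-minimal structure expanding the ordered real field $(\mathbb{R},+,\cdot,\ge)$; ''definable'' means definable in it. $|\cdot|$ is the Euclidean norm. For $S\subset\mathbb{R}^q$, the inner distance $d_{in}^S(x,x')\in[0,\infty]$ is the infimum of the lengths of the rectifiable paths in $S$ joining $x$ and $x'$. $S$ is LNE (Lipschitz normally embedded) if there is $L>0$ with $d_{in}^S(x,x')\le L|x-x'|$ for all $x,x'\in S$. $S$ is locally LNE at $\infty$ if there is a neighbourhood $U$ of $\infty$ in $\mathbb{R}^q$ (i.e. the complement of a compact set) such that $S\cap U$ is LNE. The asymptotic set of $S$ at $\infty$ is $S^\infty:=\{u\in\mathbf{S}^{q-1}:\ \exists (x_n)_n\subset S,\ |x_n|\to\infty,\ x_n/|x_n|\to u\}$, where $\mathbf{S}^{q-1}$ is the unit sphere of $\mathbb{R}^q$. The non-negative cone is $\widehat{X^\infty}^+:=\bigcup_{u\in X^\infty}\{tu: t\ge 0\}$. By the conical structure of definable sets at infinity there is $R_0>0$ such that for $R\ge R_0$ the set $\{x\in X:|x|\ge R\}$ is homeomorphic to $\{x\in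 X:|x|=R_0\}\times[R,\infty)$ by a homeomorphism carrying $\{x \in X: |x|=\rho\}$ onto $\{x\in X:|x|=R_0\}\times\{\rho\}$ for each $\rho\ge R$. The connected components $\mathcal{C}_1,\dots,\mathcal{C}_c$ of the germ $(X,\infty)$ are the germs at infinity of the finitely many connected components of $\{x\in X:|x|\ge R\}$, $R\ge R_0$ (local LNE-ness at $\infty$ and asymptotic sets are those of these representatives, for any sufficiently large $R$). *)

(* Defs.v *)
From HB Require Import structures.
From mathcomp Require Import all_boot all_order all_algebra.
From mathcomp Require Import all_classical all_reals all_analysis.

Set Implicit Arguments.
Unset Strict Implicit.
Unset Printing Implicit Defensive.

Import Order.TTheory GRing.Theory Num.Theory.
Import numFieldNormedType.Exports.

Local Open Scope classical_set_scope.
Local Open Scope ring_scope.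

(* Definability is with real parameters (singletons are definable).  The last
   field is o-minimality; library intervals may be degenerate or unbounded, so
   they account for points, bounded intervals and half-lines alike. *)
Record o_minimal_structure (R : realType) := OMinimalStructure {
  definable : forall n : nat, set (set 'rV[R]_n) ;
  definable_set0 : forall n, definable (@set0 'rV[R]_n) ;
  definable_setC : forall n (A : set 'rV[R]_n), definable A -> definable (~` A) ;
  definable_setU : forall n (A B : set 'rV[R]_n),
    definable A -> definable B -> definable (A `|` B) ;
  definable_prod : forall m n (A : set 'rV[R]_m) (B : set 'rV[R]_n),
    definable A -> definable B ->
    definable [set x : 'rV[R]_(m + n) | A (lsubmx x) /\ B (rsubmx x)] ;
  definable_proj : forall m n (A : set 'rV[R]_(m + n)),
    definable A -> definable [set lsubmx x | x in A] ;
  definable_diag : forall n (i j : 'I_n),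
    definable [set x : 'rV[R]_n | x 0 i = x 0 j] ;
  definable_point : forall a : R, definable [set x : 'rV[R]_1 | x 0 0 = a] ;
  definable_add : definable [set x : 'rV[R]_3 | x 0 0 + x 0 1 = x 0 2] ;
  definable_mul : definable [set x : 'rV[R]_3 | x 0 0 * x 0 1 = x 0 2] ;
  definable_ge : definable [set x : 'rV[R]_2 | x 0 0 >= x 0 1] ;
  definable_o_minimal : forall A : set 'rV[R]_1, definable A ->
    exists s : seq (interval R), A = [set x | exists2 i, i \in s & x 0 0 \in i]
}.

Section EuclideanSets.
Variables (R : realType) (q : nat).
Implicit Types (S X : set 'rV[R]_q) (x y u : 'rV[R]_q) (g : R -> 'rV[R]_q).

(* The library norm on 'rV[R]_q is the sup norm; its topology is the usual one. *)
Definition enorm x : R := Num.sqrt (\sum_(i < q) x 0 i ^+ 2).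

(* A subdivision 0 = t_0 < t_1 < ... < t_k = 1 is encoded, as for the library's
   [variation], by the sequence s of t_1, ..., t_k. *)
Definition polygon_length g (s : seq R) : R :=
  let F := g \o nth 1 (0 :: s) in
  \sum_(0 <= k < size s) enorm (F k.+1 - F k).

Definition path_length g : \bar R :=
  ereal_sup [set (polygon_length g s)%:E | s in [set s | itv_partition 0 1 s]].

Definition rectifiable_path_in S x y g : Prop :=
  [/\ {within `[0, 1], continuous g},
      forall t : R, t \in `[0, 1] -> S (g t),
      g 0 = x, g 1 = y & (path_length g < +oo)%E].

Definition inner_dist S x y : \bar R :=
  ereal_inf [set path_length g | g in rectifiable_path_in S x y].

Definition LNE S : Prop :=
  exists2 L : R, 0 < L &
    forall x y, S x -> S y -> (inner_dist S x y <= (L * enorm (x - y))%:E)%E.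

Definition locally_LNE_at_infinity S : Prop :=
  exists2 K : set 'rV[R]_q, compact K & LNE (S `&` ~` K).

Definition asymptotic_set S : set 'rV[R]_q :=
  [set u | enorm u = 1 /\
    exists x_ : nat -> 'rV[R]_q,
      [/\ forall n, S (x_ n),
          enorm (x_ n) @[n --> \oo] --> +oo &
          (enorm (x_ n))^-1 *: x_ n @[n --> \oo] --> u]].

Definition nonneg_cone S : set 'rV[R]_q :=
  \bigcup_(u in S) [set t *: u | t in [set t : R | 0 <= t]].

Definition link X (r : R) : set 'rV[R]_q := X `&` [set x | enorm x = r].

Definition end_part X (r : R) : set 'rV[R]_q := X `&` [set x | r <= enorm x].

Definition conical_radius X (R0 : R) : Prop :=
  0 < R0 /\
  forall r : R, R0 <= r ->
    exists (h : 'rV[R]_q -> 'rV[R]_q * R) (k : 'rV[R]_q * R -> 'rV[R]_q),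
      [/\ set_bij (end_part X r) (link X R0 `*` `[r, +oo[) h,
          {within end_part X r, continuous h},
          {within link X R0 `*` `[r, +oo[, continuous k},
          {in end_part X r, cancel h k} &
          forall rho : R, r <= rho ->
            h @` link X rho = link X R0 `*` [set rho]].

Definition connected_components X : set (set 'rV[R]_q) :=
  [set connected_component X x | x in X].

(* The germs are given by representatives: C_0, ..., C_(c-1) enumerate, without
   repetition, the connected components of X outside a ball of radius r >= R0. *)
Definition germ_components_at_infinity X (c : nat) (C : 'I_c -> set 'rV[R]_q)
    : Prop :=
  exists R0 r : R,
    [/\ conical_radius X R0, R0 <= r &
        set_bij [set: 'I_c] (connected_components (end_part X r)) C].

End EuclideanSets.

(* Main.v *)
Require Import Defs.
From mathcomp Require Import all_boot all_order all_algebra.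
From mathcomp Require Import all_classical all_reals all_analysis.
From mathcomp Require Import ring lra.

(** Write [T_S] for the set of limits of points of [t^-1 S] along scales [t]
    tending to infinity ([tangent_at_infinity]).  Off the origin, the cone over
    the asymptotic set of [S] is [T_S], so the claim is that any two points of
    [T_X] are joined inside [T_X], up to the origin, by a path whose length is at
    most a constant times their distance.

    Each nonzero [x] in [T_X] lies in [T_(C_i)] for some component [C_i], and for
    only one since the asymptotic sets are disjoint.

    If [x] and [y] belong to the same [T_(C_i)], take points of [C_i] near [t x]
    and [t y], join them in [C_i] by a path of length at most about
    [L t |x - y|], rescale by [t^-1], and pass to a limit as [t] tends to
    infinity ([LNE_at_infinity_joined]).  This needs both [x] and [y] to be
    approached at the same scales [t], whereas a tangent direction is only
    approached along some scales: for an arbitrary closed set, two directions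
    could be visited at different scales.  O-minimality removes the obstacle.
    The scales at which [X] comes close to the ray through [x] form a definable
    unbounded subset of the line, hence contain a half-line
    ([definable_tangent_tracked]).  The argument is applied to [X] itself, so the
    definability of the components is never at stake: near a direction tangent
    to [C_i] alone, the far points of [X] are points of [C_i]
    ([tracked_by_component]).

    If [x] and [y] belong to different components, the two closed cones meet
    only at the origin, so that [|x| + |y|] is at most a constant times
    [|x - y|] ([tangent_cones_apart]), and the path through the apex is short
    enough ([lipschitz_joined_via_apex]).

    Lengths are handled through Lipschitz paths on [[0, 1]] for the sup norm,
    which only costs factors [q] in the constants: a Lipschitz path is
    rectifiable, a rectifiable path can be reparametrized into a Lipschitz one
    ([inner_dist_lipschitz_joined]), and Lipschitz paths have limits
    ([lipschitz_path_limit]). *)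

Set Implicit Arguments.
Unset Strict Implicit.
Unset Printing Implicit Defensive.

Import Order.TTheory GRing.Theory Num.Theory.
Import numFieldNormedType.Exports.

Local Open Scope classical_set_scope.
Local Open Scope ring_scope.

(** * Definable sets *)

Section Definability.
Variables (R : realType) (D : o_minimal_structure R).

Lemma eq_definable n (A B : set 'rV[R]_n) :
  definable D A -> (forall x, A x <-> B x) -> definable D B.
Proof. by move=> dA AB; rewrite (_ : B = A)// predeqE => x; rewrite AB. Qed.

Lemma definable_setI n (A B : set 'rV[R]_n) :
  definable D A -> definable D B -> definable D (A `&` B).
Proof.
move=> dA dB; rewrite -[A `&` B]setCK setCI.
by apply/definable_setC/definable_setU; exact: definable_setC.
Qed.

Lemma definable_setT n : definable D [set: 'rV[R]_n].
Proof. by rewrite -setC0; exact/definable_setC/definable_set0. Qed.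

Lemma definable_forall n (I : finType) (A : I -> set 'rV[R]_n) :
  (forall i, definable D (A i)) -> definable D [set x | forall i, A i x].
Proof.
move=> dA.
suff H (s : seq I) : definable D [set x | forall i, i \in s -> A i x].
  rewrite [X in definable D X](_ : _ =
    [set x | forall i, i \in enum I -> A i x]) //.
  by apply/seteqP; split=> x Ax i => [_|]; apply: Ax; rewrite mem_enum.
elim: s => [|j s ih].
  by rewrite [X in definable D X](_ : _ = setT) ?predeqE //;
    exact: definable_setT.
rewrite [X in definable D X](_ : _ =
    A j `&` [set x | forall i, i \in s -> A i x]).
  exact: definable_setI.
apply/seteqP; split=> [x Ax|x [Aj Ax] i].
  by split=> [|i si]; apply: Ax; rewrite inE ?eqxx// si orbT.
by rewrite inE => /predU1P[->|/Ax].
Qed.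

(** Cylinders, permutations and duplications of coordinates at once: [f] says
    which coordinate of the big space feeds each coordinate of [A].  The graph
    of the coordinate map is cut out by diagonals, then projected. *)
Lemma definable_preimage_coord n m (f : 'I_m -> 'I_n) (A : set 'rV[R]_m) :
  definable D A -> definable D [set x | A (\row_k x 0 (f k))].
Proof.
move=> dA.
pose G : set 'rV[R]_(n + m) := [set z | setT (lsubmx z) /\ A (rsubmx z)] `&`
  [set z | forall k, z 0 (lshift m (f k)) = z 0 (rshift n k)].
have dG : definable D G.
  apply: definable_setI.
    by apply: definable_prod => //; exact: definable_setT.
  by apply: definable_forall => k; exact: definable_diag.
rewrite [X in definable D X](_ : _ = [set lsubmx z | z in G]);
  first exact: definable_proj.
apply/seteqP; split=> [x /= Ax|_ [z [[_ Az] zE] <-]] /=.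
  exists (row_mx x (\row_k x 0 (f k))); last by rewrite row_mxKl.
  split; first by split => //=; rewrite row_mxKr.
  by move=> k /=; rewrite row_mxEl row_mxEr mxE.
suff -> : \row_k lsubmx z 0 (f k) = rsubmx z by [].
by apply/rowP => k; rewrite !mxE zE.
Qed.

(** Linear inequalities, with their real coefficient: the graph of [x |-> a x]
    comes from that of the product by fixing a factor. *)
Lemma definable_linear_le n (a : R) (i j : 'I_n) :
  definable D [set x | x 0 i <= a * x 0 j] /\
  definable D [set x | a * x 0 j <= x 0 i].
Proof.
(* Two extra coordinates: [p] carries the coefficient, [w] the product. *)
pose p : 'I_(n + 2) := rshift n 0; pose w : 'I_(n + 2) := rshift n 1.
pose u (k : 'I_n) : 'I_(n + 2) := lshift 2 k.
pose Q : set 'rV[R]_(n + 2) :=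
  [set z | z 0 p = a] `&` [set z | z 0 p * z 0 (u j) = z 0 w].
have dQ : definable D Q.
  apply: definable_setI.
    refine (eq_definable
      (definable_preimage_coord (fun=> p) (definable_point D a)) _).
    by move=> x /=; rewrite mxE.
  refine (eq_definable (definable_preimage_coord
    (fun k : 'I_3 => nth w [:: p; u j] k) (definable_mul D)) _).
  by move=> x /=; rewrite !mxE.
have dge k l : definable D [set z : 'rV[R]_(n + 2) | z 0 k >= z 0 l].
  refine (eq_definable (definable_preimage_coord
    (fun i : 'I_2 => nth l [:: k] i) (definable_ge D)) _).
  by move=> x /=; rewrite !mxE.
pose e (x : 'rV[R]_n) : 'rV[R]_(n + 2) :=
  row_mx x (\row_k (if k == 0 then a else a * x 0 j)).
have ex x : Q (e x).
  by split; rewrite /= /e /p /w /u ?row_mxEr ?row_mxEl !mxE.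
have Qe z : Q z -> z 0 w = a * z 0 (u j) by move=> [/= <- <-].
split.
- rewrite [X in definable D X](_ : _ =
      [set lsubmx z | z in Q `&` [set z | z 0 w >= z 0 (u i)]]).
    exact: definable_proj (definable_setI dQ (dge _ _)).
  apply/seteqP; split=> [x /= le_x|_ [z [Qz /= le_z] <-]].
    exists (e x); last by rewrite row_mxKl.
    by split; [exact: ex|rewrite /= /e /w /u row_mxEr row_mxEl !mxE].
  by rewrite /= !mxE -(Qe _ Qz).
- rewrite [X in definable D X](_ : _ =
      [set lsubmx z | z in Q `&` [set z | z 0 (u i) >= z 0 w]]).
    exact: definable_proj (definable_setI dQ (dge _ _)).
  apply/seteqP; split=> [x /= le_x|_ [z [Qz /= le_z] <-]].
    exists (e x); last by rewrite row_mxKl.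
    by split; [exact: ex|rewrite /= /e /w /u row_mxEr row_mxEl !mxE].
  by rewrite /= !mxE -(Qe _ Qz).
Qed.

(** O-minimality enters only here: a finite union of intervals that is
    unbounded above has an unbounded member, hence contains a half-line. *)
Lemma definable_unbounded_tail (A : set 'rV[R]_1) : definable D A ->
  (forall M, exists2 t, M < t & A (const_mx t)) ->
  exists M, forall t, M < t -> A (const_mx t).
Proof.
move=> /definable_o_minimal[s ->] unb.
pose U (s : seq (interval R)) t := exists2 i, i \in s & t \in i.
have {}unb M : exists2 t, M < t & U s t.
  by have [t Mt [i si]] := unb M; rewrite mxE => it; exists t => //; exists i.
suff [[M H]|[M H]] : (exists M, forall t, M < t -> U s t) \/
    (exists M, forall t, M < t -> ~ U s t).
- by exists M => t /H[i si it]; exists i; rewrite // mxE.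
- by have [t /H] := unb M.
elim: s {unb} => [|[l u] s [[M H]|[M H]]].
- by right; exists 0 => t _ [].
- by left; exists M => t /H[i si it]; exists i => //; rewrite inE si orbT.
have [[N HN]|[N HN]] : (exists N, forall t, N < t -> t \in Interval l u) \/
    (exists N, forall t, N < t -> t \notin Interval l u).
- case: u => [b y|[]].
  + right; exists y => t yt; rewrite itv_boundlr negb_and; apply/orP; right.
    by rewrite -ltNge; case: b; rewrite bnd_simp// ltW.
  + by right; exists 0 => t _; rewrite itv_boundlr andbF.
  + case: l => [b x|[]].
    * left; exists x => t xt; rewrite itv_boundlr andbT.
      by case: b; rewrite bnd_simp// ltW.
    * by left; exists 0 => t _; rewrite itv_boundlr.
    * by right; exists 0 => t _; rewrite itv_boundlr.
- by left; exists N => t /HN; exists (Interval l u); rewrite ?inE ?eqxx.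
- right; exists (Num.max M N) => t; rewrite gt_max => /andP[Mt Nt] [i].
  rewrite inE => /predU1P[->|si it]; first exact/negP/HN.
  by apply: (H t) => //; exists i.
Qed.

End Definability.

(** * Tangent directions at infinity *)

Section TangentDirections.
Variables (R : realType) (q : nat).
Implicit Types (S X : set 'rV[R]_q) (x y w : 'rV[R]_q).

Lemma mx_norm_le x (e : R) : 0 <= e ->
  (`|x| <= e) <-> (forall i, `|x 0 i| <= e).
Proof.
move=> e0; have -> : `|x| = mx_norm x by [].
rewrite mx_normrE; split=> [/bigmax_leP[_ H] i|H].
  exact: (H (0, i)).
by apply/bigmax_leP; split=> // -[i j] _ /=; rewrite ord1.
Qed.

Lemma mx_norm_coord x i : `|x 0 i| <= `|x|.
Proof. by apply: (mx_norm_le x (normr_ge0 x)).1. Qed.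

Lemma enormZ (a : R) x : enorm (a *: x) = `|a| * enorm x.
Proof.
rewrite /enorm -sqrtr_sqr -sqrtrM ?sqr_ge0// mulr_sumr.
by congr Num.sqrt; apply: eq_bigr => i _; rewrite mxE exprMn.
Qed.

Lemma norm_le_enorm x : `|x| <= enorm x.
Proof.
apply/mx_norm_le => [|i]; first exact: sqrtr_ge0.
rewrite -sqrtr_sqr ler_wsqrtr// (bigD1 i)//= lerDl sumr_ge0// => j _.
exact: sqr_ge0.
Qed.

Lemma enorm_le_norm x : enorm x <= q%:R * `|x|.
Proof.
rewrite -[leRHS]ger0_norm ?mulr_ge0// -sqrtr_sqr ler_wsqrtr//.
apply: (@le_trans _ _ (\sum_(i < q) `|x| ^+ 2)).
  apply: ler_sum => i _; rewrite -[leLHS]real_normK ?num_real//.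
  by rewrite ler_pXn2r ?nnegrE//; exact: mx_norm_coord.
rewrite sumr_const card_ord -[leLHS]mulr_natl exprMn ler_wpM2r ?sqr_ge0//.
rewrite -natrX ler_nat; case: (q) => // n; exact: leq_pmulr.
Qed.

Lemma enorm_gt0 x : x != 0 -> 0 < enorm x.
Proof. by move=> x0; apply: lt_le_trans (norm_le_enorm x); rewrite normr_gt0. Qed.

Lemma enorm_continuous : continuous (@enorm R q).
Proof.
move=> x; apply: continuous_comp; last exact: sqrt_continuous.
have FF : Filter (nbhs x) := nbhs_filter x.
refine (@cvg_big _ _ _ _ _ _ _ _ _ _ _ FF _) => [|i _].
  exact: add_continuous.
exact: (@cvg_comp _ _ _ _ (fun y : R => y ^+ 2) _ _ _
  (@coord_continuous _ _ _ _ _ _) (@exprn_continuous _ _ _)).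
Qed.

(** The points of [S] seen from infinity at scale [t] are the points of
    [t^-1 S]; [tangent_at_infinity S] collects their limits along some scales
    tending to infinity, [tracked_at_infinity S] their limits along all
    scales. *)
Definition close_at_scale S w (e t : R) :=
  exists2 x, S x & `|x - t *: w| <= e * t.

Definition tangent_at_infinity S w := forall e M : R, 0 < e ->
  exists2 t, M < t & close_at_scale S w e t.

Definition tracked_at_infinity S w := forall e : R, 0 < e ->
  exists M, forall t, M < t -> close_at_scale S w e t.

Lemma close_at_scale_le S w e e' t : 0 <= t -> e <= e' ->
  close_at_scale S w e t -> close_at_scale S w e' t.
Proof.
move=> t0 ee' [x Sx h]; exists x => //; apply: le_trans h _.
exact: ler_wpM2r.
Qed.

(** Away from the origin, the cone over the asymptotic set is the set of tangent
    directions: a scale for the vector [t *: u] is a radius divided by [t]. *)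
Lemma asymptotic_cone_tangent S w : w != 0 ->
  nonneg_cone (asymptotic_set S) w <-> tangent_at_infinity S w.
Proof.
move=> w0; split.
  move=> [u [u1 [x_ [Sx xoo xu]]] [a /= a0 aw]] e M e0.
  have {}a0 : 0 < a.
    by rewrite lt_neqAle a0 andbT; apply: contraNneq w0 => a0';
      rewrite -aw -a0' scale0r.
  have ea : 0 < e / a by rewrite divr_gt0.
  move/cvgryPgt : xoo => /(_ (Num.max (M * a) 0)) xoo.
  move/cvgrPdist_le : xu => /(_ _ ea) xu.
  have [n _ /(_ n (leqnn _)) [H1 H2]] := filterI xoo xu.
  move: H1; rewrite gt_max => /andP[H1 H3].
  (* [u = a^-1 w], so the radius of [x_ n] is the scale of [w] times [a]. *)
  exists (enorm (x_ n) / a); first by rewrite ltr_pdivlMr.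
  exists (x_ n); first exact: Sx.
  rewrite -aw scalerA divfK ?gt_eqF//.
  have -> : x_ n - enorm (x_ n) *: u =
      - (enorm (x_ n) *: (u - (enorm (x_ n))^-1 *: x_ n)).
    by rewrite scalerBr scalerA mulfV ?gt_eqF// scale1r opprB.
  rewrite normrN normrZ gtr0_norm//.
  by rewrite mulrCA ler_pM2l//.
move=> T.
have ew := enorm_gt0 w0.
exists ((enorm w)^-1 *: w); last first.
  by exists (enorm w); rewrite //= ?ltW// scalerA mulfV ?gt_eqF// scale1r.
split; first by rewrite enormZ gtr0_norm ?invr_gt0// mulVf ?gt_eqF.
have /choice[tx Htx] : forall n : nat, exists tx : R * 'rV[R]_q,
    [/\ n%:R < tx.1, S tx.2 & `|tx.2 - tx.1 *: w| <= n.+1%:R^-1 * tx.1].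
  move=> n; have [|t nt [x Sx H]] := T n.+1%:R^-1 n%:R.
    by rewrite invr_gt0.
  by exists (t, x).
pose t n := (tx n).1; pose x n := (tx n).2.
have t0 n : 0 < t n by case: (Htx n) => /(le_lt_trans _) h _ _; exact: h.
have tx_w : (t n)^-1 *: x n @[n --> \oo] --> w.
  apply/cvgrPdist_le => e e0.
  near=> n.
  rewrite distrC; case: (Htx n) => _ _; rewrite -/(t n) -/(x n) => h.
  have -> : (t n)^-1 *: x n - w = (t n)^-1 *: (x n - t n *: w).
    by rewrite scalerBr scalerA mulVf ?gt_eqF// scale1r.
  rewrite normrZ gtr0_norm ?invr_gt0// ler_pdivrMl// [leRHS]mulrC.
  apply: le_trans h _; apply: ler_wpM2r; first exact: ltW.
  by near: n; apply: filterS (near_infty_natSinv_lt (PosNum e0)) => m /ltW.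
have en_w : enorm ((t n)^-1 *: x n) @[n --> \oo] --> enorm w.
  exact: (@cvg_comp _ _ _ _ _ _ _ _ tx_w (@enorm_continuous w)).
exists x; split.
- by move=> n; case: (Htx n).
- apply/cvgryPge => A.
  have ew2 : enorm w / 2 < enorm w by rewrite ltr_pdivrMr// ltr_pMr// ltr1n.
  move/cvgr_gt : en_w => /(_ _ ew2) en_w.
  near=> n.
  have : enorm w / 2 < enorm ((t n)^-1 *: x n) by near: n.
  rewrite enormZ gtr0_norm ?invr_gt0// ltr_pdivlMl// => h.
  apply: ltW; apply: le_lt_trans h.
  rewrite -ler_pdivrMr ?divr_gt0//.
  apply: (@le_trans _ _ n%:R); last by case: (Htx n) => /ltW.
  near: n; exact: nbhs_infty_ger.
(* Normalizing [x n] and normalizing its rescaling by [t n] agree; the latter is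
   a continuous function of a sequence tending to [w]. *)
- have -> : (fun n => (enorm (x n))^-1 *: x n) =
      (fun n => (enorm ((t n)^-1 *: x n))^-1 *: ((t n)^-1 *: x n)).
    apply/funext => n; rewrite enormZ gtr0_norm ?invr_gt0//.
    by rewrite scalerA invfM invrK -mulrA (mulrC (t n)) mulfVK ?gt_eqF.
  by apply: cvgZ => //; apply: cvgV => //; rewrite gt_eqF.
Unshelve. all: by end_near. Qed.

(** The scales at which the definable set [X] comes close to the ray through
    [w] form a definable subset of the line.  Closeness is in the sup norm, so
    that it is a conjunction of linear inequalities. *)
Lemma definable_tangent_tracked (D : o_minimal_structure R) X w :
  definable D X -> tangent_at_infinity X w -> tracked_at_infinity X w.
Proof.
move=> dX T e e0.
(* Coordinate [c] is the scale [t], the coordinates [p k] are those of [x]. *)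
pose c : 'I_(1 + q) := lshift q 0; pose p (k : 'I_q) := rshift 1 k.
pose W : set 'rV[R]_(1 + q) := [set z | setT (lsubmx z) /\ X (rsubmx z)] `&`
  [set z | forall k, (z 0 (p k) <= (w 0 k + e) * z 0 c) /\
                     ((w 0 k - e) * z 0 c <= z 0 (p k))].
have dW : definable D W.
  apply: definable_setI; first exact: definable_prod (definable_setT _ _) dX.
  apply: definable_forall => k.
  apply: definable_setI; first exact: (definable_linear_le D _ _ _).1.
  exact: (definable_linear_le D _ _ _).2.
have WE t : 0 <= t ->
    [set lsubmx z | z in W] (const_mx t) <-> close_at_scale X w e t.
  move=> t0; have et0 : 0 <= e * t by rewrite mulr_ge0// ltW.
  split=> [[z [[_ Xz] zW] zt]|[x Xx xt]].
    exists (rsubmx z) => //; apply/mx_norm_le => // k.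
    have zc : z 0 c = t by move/rowP : zt => /(_ 0); rewrite !mxE.
    have [] := zW k; rewrite zc -/(p k) !mxE -/(p k) ler_norml => h1 h2.
    apply/andP; split; lra.
  exists (row_mx (const_mx t) x); last by rewrite row_mxKl.
  split; first by split => //=; rewrite row_mxKr.
  move=> k; rewrite /c /p /= row_mxEl row_mxEr mxE.
  move/(mx_norm_le _ et0) : xt => /(_ k); rewrite !mxE ler_norml => /andP[h1 h2].
  split; lra.
have [|M HM] := definable_unbounded_tail (definable_proj dW).
  move=> M; have [t] := T e (Num.max M 0) e0; rewrite gt_max => /andP[Mt t0] h.
  by exists t => //; apply/WE => //; exact: ltW.
exists (Num.max M 0) => t; rewrite gt_max => /andP[Mt t0].
by apply/WE; [exact: ltW|exact: HM].
Qed.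

(** The witnesses [e] and [M] of a failure of tangency may be shrunk and raised,
    so finitely many failures have common witnesses. *)
Lemma finitely_many_not_tangent (I : finType) (P : pred I)
    (C : I -> set 'rV[R]_q) w :
  (forall j, P j -> ~ tangent_at_infinity (C j) w) ->
  exists e M : R, [/\ 0 < e, 0 <= M & forall j t, P j -> M < t ->
    ~ close_at_scale (C j) w e t].
Proof.
move=> nT.
suff [e [M [e0 M0 H]]] : exists e M : R, [/\ 0 < e, 0 <= M & forall j t,
    j \in enum I -> P j -> M < t -> ~ close_at_scale (C j) w e t].
  by exists e, M; split=> // j t; apply: H; rewrite mem_enum.
elim: (enum I) => [|i s [e [M [e0 M0 H]]]]; first by exists 1, 0.
have [Pi|nPi] := boolP (P i); last first.
  exists e, M; split=> // j t; rewrite inE => /predU1P[-> Pi|js].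
    by rewrite Pi in nPi.
  exact: H.
have /nT := Pi; rewrite /tangent_at_infinity => /existsNP[e1] /existsNP[M1].
move=> /not_implyP[e10] /forall2NP H1.
exists (Num.min e e1), (Num.max M M1); split; first by rewrite lt_min e0.
  by rewrite le_max M0.
move=> j t js Pj; rewrite gt_max => /andP[Mt M1t] h.
have t0 : 0 <= t by rewrite ltW// (le_lt_trans M0).
have hl e2 : Num.min e e1 <= e2 -> close_at_scale (C j) w e2 t.
  by move=> ee2; exact: close_at_scale_le h.
move: js; rewrite inE => /predU1P[ji|js].
  by case: (H1 t) => [/(_ M1t)//|]; apply; rewrite -ji; apply: hl;
      rewrite ge_min lexx orbT.
by apply: (H j t js Pj Mt); apply: hl; rewrite ge_min lexx.
Qed.

Lemma close_at_scale_far w (r : R) : w != 0 -> 0 <= r ->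
  forall x t, 2 * r / `|w| < t -> `|x - t *: w| <= `|w| / 2 * t -> r <= `|x|.
Proof.
move=> w0 r0 x t rt xt.
have wp : 0 < `|w| by rewrite normr_gt0.
have t0 : 0 < t by apply: le_lt_trans rt; rewrite divr_ge0// mulr_ge0.
have tw : `|t *: w| = t * `|w| by rewrite normrZ gtr0_norm.
have h := ler_normB x (x - t *: w).
rewrite subKr tw in h.
move: rt; rewrite ltr_pdivrMr// => rt.
lra.
Qed.

Section Components.
Variables (I : finType) (X : set 'rV[R]_q) (C : I -> set 'rV[R]_q) (r : R).
Hypothesis r0 : 0 <= r.
Hypothesis cover : forall x, X x -> r <= enorm x -> exists i, C i x.

Lemma tangent_of_component w : w != 0 -> tangent_at_infinity X w ->
  exists i, tangent_at_infinity (C i) w.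
Proof.
move=> w0 T; apply: contrapT => /forallNP nT.
have [e [M [e0 M0 H]]] :=
  @finitely_many_not_tangent _ predT C w (fun j _ => nT j).
have ep : 0 < Num.min e (`|w| / 2) by rewrite lt_min e0 divr_gt0// normr_gt0.
have [t] := T _ (Num.max M (2 * r / `|w|)) ep.
rewrite gt_max => /andP[Mt rt] [x Xx xt].
have t0 : 0 <= t by rewrite ltW// (le_lt_trans M0).
have [] := @cover x Xx.
  apply: le_trans (norm_le_enorm x).
  apply: (close_at_scale_far w0 r0 rt); apply: le_trans xt _.
  by rewrite ler_wpM2r// ge_min lexx orbT.
move=> i Cix; apply: (H i t isT Mt); exists x => //.
by apply: le_trans xt _; rewrite ler_wpM2r// ge_min lexx.
Qed.

(** A far point of [X] close to the ray through [w] lies in some component; it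
    cannot be one to which [w] is not tangent. *)
Lemma tracked_by_component i w : w != 0 -> tracked_at_infinity X w ->
  (forall j, j != i -> ~ tangent_at_infinity (C j) w) ->
  tracked_at_infinity (C i) w.
Proof.
move=> w0 T nT e e0.
have [e1 [M [e10 M0 H]]] :=
  @finitely_many_not_tangent _ [pred j | j != i] C w nT.
have ep : 0 < Num.min (Num.min e e1) (`|w| / 2).
  by rewrite !lt_min e0 e10 divr_gt0// normr_gt0.
have [N HN] := T _ ep.
exists (Num.max N (Num.max M (2 * r / `|w|))) => t.
rewrite !gt_max => /and3P[Nt Mt rt].
have [x Xx xt] := HN t Nt.
have t0 : 0 <= t by rewrite ltW// (le_lt_trans M0).
have xl e2 : Num.min (Num.min e e1) (`|w| / 2) <= e2 -> `|x - t *: w| <= e2 * t.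
  by move=> ee2; apply: le_trans xt _; exact: ler_wpM2r.
have [] := @cover x Xx.
  apply: le_trans (norm_le_enorm x).
  by apply: (close_at_scale_far w0 r0 rt); apply: xl; rewrite !ge_min lexx !orbT.
move=> j Cjx; have [ji|ji] := eqVneq j i.
  by rewrite -ji; exists x => //; apply: xl; rewrite !ge_min lexx.
exfalso; apply: (H j t ji Mt); exists x => //.
by apply: xl; rewrite !ge_min lexx !orbT.
Qed.

End Components.

End TangentDirections.

(** * Lipschitz paths and the inner distance *)

Section LipschitzPaths.
Variables (R : realType) (q : nat).
Implicit Types (S : set 'rV[R]_q) (x y w : 'rV[R]_q) (f g : R -> 'rV[R]_q).

Definition lipschitz01 f (M : R) :=
  forall s t, s \in `[0, 1] -> t \in `[0, 1] -> `|f s - f t| <= M * `|s - t|.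

Definition lipschitz_joined S x y (M : R) := exists f,
  [/\ f 0 = x, f 1 = y, lipschitz01 f M &
      forall s, s \in `[0, 1] -> S (f s)].

Lemma in01_0 : (0 : R) \in `[0, 1]. Proof. by rewrite in_itv/= lexx ler01. Qed.
Lemma in01_1 : (1 : R) \in `[0, 1]. Proof. by rewrite in_itv/= lexx ler01. Qed.

Lemma lipschitz_joined_inner_dist S x y (M : R) : 0 <= M ->
  lipschitz_joined S x y M -> (inner_dist S x y <= (q%:R * M)%:E)%E.
Proof.
move=> M0 [f [f0 f1 fM fS]].
have len : (path_length f <= (q%:R * M)%:E)%E.
  apply: ge_ereal_sup => _ [s /= s01 <-]; rewrite lee_fin /polygon_length.
  pose T := nth 1 (0 :: s).
  have T01 k : (k < (size s).+1)%N -> T k \in `[0, 1].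
    move=> ks; rewrite in_itv/= (itv_partition_nth_ge ks s01).
    by rewrite (itv_partition_nth_le ks s01).
  have Tle k : (k < size s)%N -> T k <= T k.+1.
    by move=> ks; apply: (nondecreasing_fun_itv_partition (f := id) _ s01).
  apply: (@le_trans _ _ (\sum_(0 <= k < size s) (q%:R * M) * (T k.+1 - T k))).
    rewrite !big_nat; apply: ler_sum => k /andP[_ ks].
    apply: le_trans (enorm_le_norm _) _; rewrite -mulrA ler_wpM2l//.
    apply: le_trans (fM _ _ (T01 _ _) (T01 _ _)) _ => //; first exact: ltnW.
    by rewrite ger0_norm// subr_ge0 Tle.
  rewrite -mulr_sumr telescope_sumr// /T (itv_partition_nth_size 1 s01) /=.
  by rewrite subr0 mulr1.
apply: (le_trans _ len); apply: ereal_inf_lbound; exists f => //.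
split=> //; last exact: le_lt_trans len (ltry _).
apply/subspace_continuousP => t /= t01; apply/cvgrPdist_le => e e0.
have M1 : 0 < M + 1 by rewrite ltr_wpDl.
have : \forall s \near within `[0, 1]%classic (nbhs t), `|t - s| <= e / (M + 1).
  apply: cvg_within.
  by have /cvgrPdist_le := @cvg_id _ (nbhs t); apply; rewrite divr_gt0.
have : \forall s \near within `[0, 1]%classic (nbhs t), s \in `[0, 1].
  by apply: filterS (withinT _ _) => s.
apply: filterS2 => s s01 st; apply: le_trans (fM _ _ t01 s01) _.
apply: (@le_trans _ _ ((M + 1) * `|t - s|)).
  by rewrite ler_wpM2r// lerDl.
by rewrite -ler_pdivlMl// mulrC.
Qed.

(** Reparametrization by a continuous clock [V] that dominates the displacement
    of [g]: the new path reads [g] when the clock shows a given proportion of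
    its total. *)
Lemma clock_reparametrization g (V : R -> R) (L : R) :
  {within `[0, 1], continuous V} -> V 0 = 0 -> V 1 <= L ->
  (forall a b, a \in `[0, 1] -> b \in `[0, 1] -> a <= b ->
     `|g b - g a| <= V b - V a) ->
  exists f, [/\ f 0 = g 0, f 1 = g 1, lipschitz01 f L &
    forall s, s \in `[0, 1] -> exists2 t, t \in `[0, 1] & f s = g t].
Proof.
move=> cV V0 V1 gV.
have gV' a b : a \in `[0, 1] -> b \in `[0, 1] -> `|g b - g a| <= `|V b - V a|.
  move=> a01 b01; have [ab|/ltW ba] := leP a b.
    by apply: le_trans (gV a b a01 b01 ab) (ler_norm _).
  rewrite distrC [leRHS]distrC.
  by apply: le_trans (gV b a b01 a01 ba) (ler_norm _).
have V10 : 0 <= V 1.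
  have := gV 0 1 in01_0 in01_1 ler01; rewrite V0 subr0.
  by apply: le_trans; exact: normr_ge0.
have /choice[tau Htau] : forall s, exists t, s \in `[0, 1] ->
    t \in `[0, 1] /\ V t = s * V 1.
  move=> s; have [s01|_] := boolP (s \in `[0, 1]); last by exists 0.
  have [|t t01 Vt] := @IVT R V 0 1 (s * V 1) ler01 cV; last by exists t.
  rewrite V0 min_l// max_r//; move: s01; rewrite in_itv/= => /andP[s0 s1].
  by rewrite mulr_ge0//= ler_piMl.
(* [tau 0] may differ from [0], but [g] does not move while the clock stands
   still. *)
have stays a b : a \in `[0, 1] -> b \in `[0, 1] -> V a = V b -> g a = g b.
  move=> a01 b01 Vab; apply/eqP; rewrite -subr_eq0 -normr_le0.
  by apply: le_trans (gV' _ _ b01 a01) _; rewrite Vab subrr normr0.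
exists (g \o tau); split => /=.
- have [t01 Vt] := Htau 0 in01_0; apply: stays => //; first exact: in01_0.
  by rewrite Vt mul0r.
- have [t01 Vt] := Htau 1 in01_1; apply: stays => //; first exact: in01_1.
  by rewrite Vt mul1r.
- move=> s t /Htau[s01 Vs] /Htau[t01 Vt].
  apply: le_trans (gV' _ _ t01 s01) _.
  rewrite Vs Vt -mulrBl normrM mulrC (ger0_norm V10).
  exact: ler_wpM2r.
- by move=> s /Htau[t01 _]; exists (tau s).
Qed.

(** The clock is the sum of the variations of the coordinates.  Unlike the arc
    length, its continuity is that of the variation of a real function; the
    price is the factor [q]. *)
Lemma inner_dist_lipschitz_joined S x y (l : R) :
  (inner_dist S x y < l%:E)%E -> lipschitz_joined S x y (q%:R * l).
Proof.
move=> /ereal_inf_lt[_ [g [cg gS g0 g1 _] <-] gl].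
pose gi (i : 'I_q) t := g t 0 i.
have var_le i s : itv_partition 0 1 s -> variation 0 1 (gi i) s <= l.
  move=> s01; rewrite -lee_fin; apply: le_trans (ltW gl).
  apply: (@le_trans _ _ (polygon_length g s)%:E); last first.
    by apply: ereal_sup_ubound; exists s.
  rewrite lee_fin /variation /polygon_length; apply: ler_sum => k _.
  apply: le_trans (norm_le_enorm _).
  have := mx_norm_coord
    ((g \o nth 1 (0 :: s)) k.+1 - (g \o nth 1 (0 :: s)) k) i.
  by rewrite !mxE.
have bv i : bounded_variation 0 1 (gi i).
  by exists l => _ [s s01 <-]; exact: var_le.
have fv i t : t \in `[0, 1] -> total_variation 0 t (gi i) \is a fin_num.
  rewrite in_itv/= => /andP[t0 t1]; apply/bounded_variationP => //.
  exact: bounded_variationl (bv i).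
pose V t := \sum_(i < q) fine (total_variation 0 t (gi i)).
have gV a b : a \in `[0, 1] -> b \in `[0, 1] -> a <= b ->
    `|g b - g a| <= V b - V a.
  move=> a01 b01 ab.
  have D i : `|gi i b - gi i a| <=
      fine (total_variation 0 b (gi i)) - fine (total_variation 0 a (gi i)).
    have [a0 b1] : 0 <= a /\ b <= 1.
      by move: a01 b01; rewrite !in_itv/= => /andP[-> _] /andP[_ ->].
    have TD := total_variationD (gi i) a0 ab.
    have fab : total_variation a b (gi i) \is a fin_num.
      apply/bounded_variationP => //; apply: (bounded_variationr a0 ab).
      by apply: bounded_variationl (bv i) => //; exact: le_trans ab.
    rewrite TD fineD ?fv// [leRHS]addrC addKr -lee_fin fineK//.
    exact: total_variation_ge.
  rewrite /V -sumrB; apply/mx_norm_le => [|i].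
    by apply: sumr_ge0 => i _; apply: le_trans (D i).
  rewrite !mxE (bigD1 i)//=; apply: le_trans (D i) _; rewrite lerDl.
  by apply: sumr_ge0 => j _; apply: le_trans (D j).
have cV : {within `[0, 1], continuous V}.
  have cgi i : {within `[0, 1], continuous (gi i)}.
    move=> t.
    apply: (@cvg_comp _ _ _ _ (fun z : 'rV[R]_q => z 0 i) _ _ _ (cg t)).
    exact: coord_continuous.
  move=> t.
  have FF : Filter (nbhs (t : subspace `[0, 1]%classic)) := nbhs_filter _.
  refine (@cvg_big _ _ _ _ _ _ _ _ _ _ _ FF _) => [|i _].
    exact: add_continuous.
  exact: (total_variation_continuous ltr01 (cgi i) (bv i)).
have V0 : V 0 = 0.
  by rewrite /V big1// => i _; rewrite total_variationxx.
have V1 : V 1 <= q%:R * l.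
  have -> : q%:R * l = \sum_(i < q) l by rewrite sumr_const card_ord mulr_natl.
  apply: ler_sum => i _; rewrite -lee_fin fineK ?fv ?in01_1//.
  apply: ge_ereal_sup => _ [_ [s s01 <-] <-]; rewrite lee_fin.
  exact: var_le.
have [f [f0 f1 fl fg]] := clock_reparametrization cV V0 V1 gV.
exists f; split=> //; [by rewrite f0|by rewrite f1|].
by move=> s /fg[t t01 ->]; exact: gS.
Qed.

Lemma ultra_bounded_cvg (G : set_system nat) (u : nat -> 'rV[R]_q) (M : R) :
  UltraFilter G -> (\forall n \near G, `|u n| <= M) ->
  exists z : 'rV[R]_q, u n @[n --> G] --> z.
Proof.
move=> GU uM; have GP := @ultra_proper _ _ GU.
have [] := @rV_compact R q (fun=> `[- M, M]%classic)
  (fun=> segment_compact (R := R) (a := - M) (b := M)) (u @ G) _.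
  apply: filterS uM => n un i /=; rewrite in_itv/= -ler_norml.
  exact: le_trans (mx_norm_coord _ _) un.
(* An ultrafilter converges to its cluster points. *)
move=> z [_ clz]; exists z => U Uz.
have [//|nU] := in_ultra_setVsetC (u @^-1` U) GU.
by have [v [/= nUv Uv]] := clz (~` U) U nU Uz.
Qed.

Lemma exists_free_ultrafilter :
  exists G : set_system nat, UltraFilter G /\ \oo `<=` G.
Proof. exact: ultraFilterLemma. Qed.

(** Arzela-Ascoli without extraction: along a free ultrafilter all the values
    converge at once, and the Lipschitz bound passes to the limit. *)
Lemma lipschitz_path_limit (f_ : nat -> R -> 'rV[R]_q) (M : R) x y :
  (forall n, lipschitz01 (f_ n) M) ->
  f_ n 0 @[n --> \oo] --> x -> f_ n 1 @[n --> \oo] --> y ->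
  exists f, [/\ f 0 = x, f 1 = y, lipschitz01 f M &
    forall s, s \in `[0, 1] -> forall (e : R) (P : set nat), 0 < e ->
      (\forall n \near \oo, P n) -> exists2 n, P n & `|f_ n s - f s| <= e].
Proof.
move=> fM fx fy.
have [G [GU ooG]] := exists_free_ultrafilter.
have GP := @ultra_proper _ _ GU.
have lim s : s \in `[0, 1] -> exists z : 'rV[R]_q, f_ n s @[n --> G] --> z.
  move=> s01; apply: (@ultra_bounded_cvg _ _ (`|x| + 1 + `|M|)) => //.
  apply: ooG; move/cvgrPdist_le : fx => /(_ 1 ltr01).
  apply: filterS => n xn.
  have h1 := ler_normD (f_ n s - f_ n 0) (f_ n 0).
  have h2 := ler_normB x (x - f_ n 0).
  rewrite subrK in h1; rewrite subKr in h2.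
  have h3 : `|f_ n s - f_ n 0| <= `|M|.
    apply: le_trans (fM n _ _ s01 in01_0) _.
    apply: le_trans (ler_norm _) _; rewrite normrM normr_id subr0.
    move: s01; rewrite in_itv/= => /andP[s0 s1].
    by rewrite (ger0_norm s0) ler_piMr.
  lra.
have /choice[f Hf] : forall s, exists z : 'rV[R]_q, s \in `[0, 1] ->
    f_ n s @[n --> G] --> z.
  move=> s; have [/lim[z zs]|_] := boolP (s \in `[0, 1]); first by exists z.
  by exists 0.
have near_f s e : s \in `[0, 1] -> 0 < e ->
    \forall n \near G, `|f s - f_ n s| <= e.
  by move=> /Hf/cvgrPdist_le h e0; exact: h.
exists f; split.
- apply: (cvg_unique (@norm_hausdorff _ _) (Hf 0 in01_0)).
  by apply: cvg_trans fx; apply: cvg_app.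
- apply: (cvg_unique (@norm_hausdorff _ _) (Hf 1 in01_1)).
  by apply: cvg_trans fy; apply: cvg_app.
- move=> s t s01 t01; apply/ler_addgt0Pr => e e0.
  have e2 : 0 < e / 2 by rewrite divr_gt0.
  have [n [h1 h2]] :=
    filter_ex (filterI (near_f _ _ s01 e2) (near_f _ _ t01 e2)).
  have h3 := fM n s t s01 t01.
  have -> : f s - f t = (f s - f_ n s) - (f t - f_ n t) + (f_ n s - f_ n t).
    by apply/rowP => k; rewrite !mxE; ring.
  apply: le_trans (ler_normD _ _) _.
  have h4 := ler_normB (f s - f_ n s) (f t - f_ n t).
  lra.
- move=> s s01 e P e0 ooP.
  have [n [h1 h2]] := filter_ex (filterI (near_f _ _ s01 e0) (ooG _ ooP)).
  by exists n => //; rewrite distrC.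
Qed.

Lemma bounded_subsequence_limit (u : nat -> 'rV[R]_q) (M : R) :
  (forall n, `|u n| <= M) ->
  exists z : 'rV[R]_q, forall (e : R) (P : set nat), 0 < e ->
    (\forall n \near \oo, P n) -> exists2 n, P n & `|u n - z| <= e.
Proof.
move=> uM; have [G [GU ooG]] := exists_free_ultrafilter.
have GP := @ultra_proper _ _ GU.
have [|z uz] := @ultra_bounded_cvg G u M GU; first exact: nearW.
exists z => e P e0 ooP; move/cvgrPdist_le : uz => /(_ e e0) uz.
have [n [h1 h2]] := filter_ex (filterI uz (ooG _ ooP)).
by exists n => //; rewrite distrC.
Qed.

End LipschitzPaths.

(** * Cones of tangent directions *)

Section Cones.
Variables (R : realType) (q : nat).
Implicit Types (S A B W : set 'rV[R]_q) (x y w : 'rV[R]_q).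

Lemma tangent_at_infinityZ S w (a : R) : 0 < a ->
  tangent_at_infinity S w -> tangent_at_infinity S (a *: w).
Proof.
move=> a0 T e M e0; have [t Mt [x Sx xt]] := T (e / a) (M * a) (divr_gt0 e0 a0).
exists (t / a); first by rewrite ltr_pdivlMr.
exists x => //; rewrite scalerA divfK ?gt_eqF//.
by apply: le_trans xt _; rewrite mulrAC mulrA.
Qed.

Lemma tangent_at_infinity_closed S w :
  (forall e, 0 < e -> exists2 v, tangent_at_infinity S v & `|v - w| <= e) ->
  tangent_at_infinity S w.
Proof.
move=> H e M e0; have e2 : 0 < e / 2 by rewrite divr_gt0.
have [v Tv vw] := H _ e2.
have [t] := Tv _ (Num.max M 0) e2; rewrite gt_max => /andP[Mt t0] [x Sx xt].
exists t => //; exists x => //.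
have -> : x - t *: w = x - t *: v + t *: (v - w).
  by rewrite scalerBr addrA subrK.
apply: le_trans (ler_normD _ _) _; rewrite normrZ gtr0_norm//.
have : t * `|v - w| <= t * (e / 2) by rewrite ler_pM2l.
lra.
Qed.

(** A nonzero vector of the cone has the form [a *: u] with [a > 0] and
    [enorm u = 1], which makes [u] its normalization. *)
Lemma tangent_asymptotic S w : w != 0 -> tangent_at_infinity S w ->
  asymptotic_set S ((enorm w)^-1 *: w).
Proof.
move=> w0 /(asymptotic_cone_tangent S w0)[u Su [a /= a0 aw]].
have u1 : enorm u = 1 by case: Su.
have ea : enorm w = a by rewrite -aw enormZ u1 mulr1 ger0_norm.
rewrite ea -aw scalerA mulVf ?scale1r//.
by apply: contraNneq w0 => a0'; rewrite -aw a0' scale0r.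
Qed.

(** Two closed cones that meet only at the origin make a positive angle:
    rescaled to [`|x| + `|y| = 1], a sequence of pairs violating the bound more
    and more would accumulate at a common nonzero vector. *)
Lemma tangent_cones_apart A B :
  (forall w, tangent_at_infinity A w -> tangent_at_infinity B w -> w = 0) ->
  exists2 d : R, 0 < d & forall x y, tangent_at_infinity A x ->
    tangent_at_infinity B y -> d * (`|x| + `|y|) <= `|x - y|.
Proof.
move=> AB0; apply: contrapT => nd.
have /choice[p Hp] : forall n : nat, exists p : 'rV[R]_q * 'rV[R]_q,
    [/\ tangent_at_infinity A p.1, tangent_at_infinity B p.2,
        `|p.1| + `|p.2| = 1 & `|p.1 - p.2| < n.+1%:R^-1].
  move=> n; apply: contrapT => np; apply: nd.
  exists n.+1%:R^-1 => [|x y Ax By]; first by rewrite invr_gt0.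
  rewrite leNgt; apply/negP => xy; apply: np.
  have s0 : 0 < `|x| + `|y|.
    rewrite lt_neqAle addr_ge0// andbT eq_sym; apply/eqP => s0.
    by move: xy; rewrite s0 mulr0 ltNge normr_ge0.
  have si : 0 < (`|x| + `|y|)^-1 by rewrite invr_gt0.
  exists ((`|x| + `|y|)^-1 *: x, (`|x| + `|y|)^-1 *: y); split => /=.
  - exact: tangent_at_infinityZ.
  - exact: tangent_at_infinityZ.
  - by rewrite !normrZ (gtr0_norm si) -mulrDr mulVf// gt_eqF.
  - by rewrite -scalerBr normrZ (gtr0_norm si) ltr_pdivrMl// mulrC.
have [|z Hz] := @bounded_subsequence_limit R q (fun n => (p n).1) 1.
  by move=> n; case: (Hp n) => _ _ <- _; rewrite lerDl.
have small (e : R) : 0 < e -> \forall n \near \oo, n.+1%:R^-1 < e.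
  by move=> e0; exact: (near_infty_natSinv_lt (PosNum e0)).
have Az : tangent_at_infinity A z.
  apply: tangent_at_infinity_closed => e e0.
  have [n _ /= nz] := Hz e _ e0 (small _ e0).
  by exists (p n).1 => //; case: (Hp n).
have Bz : tangent_at_infinity B z.
  apply: tangent_at_infinity_closed => e e0.
  have e2 : 0 < e / 2 by rewrite divr_gt0.
  have [n /= ne nz] := Hz (e / 2) _ e2 (small _ e2).
  exists (p n).2; first by case: (Hp n).
  have -> : (p n).2 - z = ((p n).1 - z) - ((p n).1 - (p n).2).
    by apply/rowP => k; rewrite !mxE; ring.
  apply: le_trans (ler_normB _ _) _.
  have [_ _ _ h] := Hp n.
  by rewrite (splitr e) lerD// ltW// (lt_trans h).
have e0 : 0 < 8^-1 :> R by rewrite invr_gt0.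
have [n /= ne] := Hz _ _ e0 (small _ e0).
have [_ _ h1 h2] := Hp n.
rewrite (AB0 z Az Bz) subr0 => h3.
have h4 : `|(p n).2| < 8^-1 + 8^-1.
  rewrite -[(p n).2](subKr (p n).1); apply: le_lt_trans (ler_normB _ _) _.
  by apply: ler_ltD h3 _; exact: lt_trans ne.
have : `|(p n).1| + `|(p n).2| < 8^-1 + (8^-1 + 8^-1) by exact: ler_ltD.
rewrite h1; lra.
Qed.

(** The path running along one ray to the apex and out along another. *)
Lemma lipschitz_joined_via_apex W x y :
  (forall w (a : R), W w -> 0 <= a -> W (a *: w)) -> W x -> W y ->
  lipschitz_joined W x y (2 * (`|x| + `|y|)).
Proof.
move=> WZ Wx Wy.
pose f (s : R) := Num.max 0 (1 - 2 * s) *: x + Num.max 0 (2 * s - 1) *: y.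
have max_lip (a b : R) : `|Num.max 0 a - Num.max 0 b| <= `|a - b|.
  have [] := leP 0 a; have [] := leP 0 b => b0 a0; rewrite ?subrr ?sub0r ?subr0//.
  - by rewrite !ger0_norm//; lra.
  - by rewrite normrN distrC !ger0_norm//; lra.
  - by rewrite normr0.
exists f; split.
- by rewrite /f mulr0 subr0 sub0r max_r// max_l// scale1r scale0r addr0.
- rewrite /f mulr1 max_l ?max_r ?scale0r ?add0r; [|lra|lra].
  by rewrite (_ : 2 - 1 = 1 :> R) ?scale1r//; ring.
- move=> s t _ _.
  have -> : f s - f t =
      (Num.max 0 (1 - 2 * s) - Num.max 0 (1 - 2 * t)) *: x +
      (Num.max 0 (2 * s - 1) - Num.max 0 (2 * t - 1)) *: y.
    by apply/rowP => k; rewrite !mxE; ring.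
  apply: le_trans (ler_normD _ _) _; rewrite !normrZ.
  have st2 : `|2 * s - 2 * t| = 2 * `|s - t|.
    by rewrite -mulrBr normrM ger0_norm.
  have h1 : `|Num.max 0 (1 - 2 * s) - Num.max 0 (1 - 2 * t)| <= 2 * `|s - t|.
    apply: le_trans (max_lip _ _) _; rewrite -st2 distrC.
    by rewrite (_ : 1 - 2 * t - (1 - 2 * s) = 2 * s - 2 * t)//; ring.
  have h2 : `|Num.max 0 (2 * s - 1) - Num.max 0 (2 * t - 1)| <= 2 * `|s - t|.
    apply: le_trans (max_lip _ _) _; rewrite -st2.
    by rewrite (_ : 2 * s - 1 - (2 * t - 1) = 2 * s - 2 * t)//; ring.
  have h3 := ler_wpM2r (normr_ge0 x) h1.
  have h4 := ler_wpM2r (normr_ge0 y) h2.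
  lra.
- move=> s _; rewrite /f; have [s1|s1] := leP (2 * s) 1.
    rewrite (@max_l _ _ 0 (2 * s - 1)); last lra.
    by rewrite scale0r addr0; apply: WZ => //; rewrite le_max lexx.
  rewrite (@max_l _ _ 0 (1 - 2 * s)); last lra.
  by rewrite scale0r add0r; apply: WZ => //; rewrite le_max lexx.
Qed.

(** Rescaling by [t^-1] paths of [S] that join points close to [t *: x] and
    [t *: y], whose lengths are controlled by [t * `|x - y|], and letting [t]
    tend to infinity.  Both ends must be reached at the same scale [t], which is
    what tracking provides. *)
Lemma LNE_at_infinity_joined S : locally_LNE_at_infinity S ->
  exists2 c : R, 0 < c & forall x y, x != 0 -> y != 0 -> x != y ->
    tracked_at_infinity S x -> tracked_at_infinity S y ->
    lipschitz_joined (tangent_at_infinity S) x y (c * `|x - y|).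
Proof.
move=> [K cK [L L0 SL]].
have [r r0 Kr] : exists2 r : R, 0 <= r & forall x, r <= `|x| -> ~ K x.
  have [N [_ KN]] := compact_bounded cK.
  exists (`|N| + 2) => [|x rx Kx]; first by rewrite addr_ge0.
  have N1 : N < `|N| + 1 by rewrite (le_lt_trans (ler_norm N))// ltrDl.
  have := le_trans rx (KN _ N1 x Kx).
  by rewrite lerD2l leNgt ltr1n.
(* One factor [q] compares the norms of [x' - y'], the other comes from the
   reparametrization; [3 > 2] makes the inner distance strictly smaller than the
   bound, so that some path is shorter than the bound. *)
exists (q%:R * (q%:R * (3 * L)) + 1) => [|x y x0 y0 xy Tx Ty].
  by rewrite ltr_wpDl// !mulr_ge0// ltW.
have xyp : 0 < `|x - y| by rewrite normr_gt0 subr_eq0.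
have q0 : 0 < q%:R :> R.
  by rewrite -(pmulr_lgt0 _ xyp); apply: lt_le_trans (enorm_le_norm _);
    rewrite enorm_gt0// subr_eq0.
pose Mx := q%:R * (q%:R * (3 * L)) * `|x - y|.
have /choice[f Hf] : forall n : nat, exists f : R -> 'rV[R]_q,
    [/\ lipschitz01 f Mx, `|f 0 - x| <= n.+1%:R^-1, `|f 1 - y| <= n.+1%:R^-1 &
        exists2 t, n%:R < t & forall s, s \in `[0, 1] -> S (t *: f s)].
  move=> n.
  (* The last two bounds keep the chosen points of [S] out of [K]; the one by
     [`|x - y| / 4] keeps their distance below [2 t `|x - y|]. *)
  pose e := Num.min (Num.min (n.+1%:R^-1) (`|x - y| / 4))
    (Num.min (`|x| / 2) (`|y| / 2)).
  have n0 : 0 < n.+1%:R^-1 :> R by rewrite invr_gt0.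
  have e0 : 0 < e by rewrite !lt_min n0 !divr_gt0// normr_gt0.
  have en : e <= n.+1%:R^-1 by rewrite !ge_min lexx.
  have exy : e <= `|x - y| / 4 by rewrite !ge_min lexx ?orbT.
  have ex : e <= `|x| / 2 by rewrite !ge_min lexx ?orbT.
  have ey : e <= `|y| / 2 by rewrite !ge_min lexx ?orbT.
  have [M1 H1] := Tx e e0; have [M2 H2] := Ty e e0.
  pose t := Num.max (Num.max M1 M2)
    (Num.max n%:R (Num.max (2 * r / `|x|) (2 * r / `|y|))) + 1.
  have : Num.max (Num.max M1 M2)
    (Num.max n%:R (Num.max (2 * r / `|x|) (2 * r / `|y|))) < t by rewrite ltrDl.
  rewrite !gt_max => /and4P[/andP[M1t M2t] nt rxt ryt].
  have t0 : 0 < t by apply: le_lt_trans nt.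
  have [x' Sx xt] := H1 t M1t; have [y' Sy yt] := H2 t M2t.
  have lt_e e2 : e <= e2 -> e * t <= e2 * t by rewrite ler_pM2r.
  have Kx : ~ K x'.
    apply: Kr; apply: (close_at_scale_far x0 r0 rxt).
    exact: le_trans xt (lt_e _ ex).
  have Ky : ~ K y'.
    apply: Kr; apply: (close_at_scale_far y0 r0 ryt).
    exact: le_trans yt (lt_e _ ey).
  have xy' : `|x' - y'| <= 2 * (t * `|x - y|).
    have -> : x' - y' = t *: (x - y) + ((x' - t *: x) - (y' - t *: y)).
      by apply/rowP => k; rewrite !mxE; ring.
    apply: le_trans (ler_normD _ _) _; rewrite normrZ gtr0_norm//.
    rewrite mulr_natl mulr2n lerD2l.
    apply: le_trans (ler_normB _ _) (le_trans (lerD xt yt) _).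
    apply: le_trans (lerD (lt_e _ exy) (lt_e _ exy)) _.
    have : 0 <= t * `|x - y| by rewrite mulr_ge0// ltW.
    lra.
  have txy : 0 < q%:R * (L * (t * `|x - y|)) by rewrite !mulr_gt0.
  have dist : (inner_dist (S `&` ~` K) x' y' <
      (q%:R * (3 * L) * (t * `|x - y|))%:E)%E.
    apply: le_lt_trans (SL x' y' (conj Sx Kx) (conj Sy Ky)) _; rewrite lte_fin.
    apply: (@le_lt_trans _ _ (L * (q%:R * (2 * (t * `|x - y|))))).
      rewrite ler_pM2l//; apply: le_trans (enorm_le_norm _) _.
      by rewrite ler_pM2l.
    rewrite -subr_gt0; apply: lt_le_trans txy _.
    by rewrite le_eqVlt; apply/orP; left; apply/eqP; ring.
  have [g [gx gy gl gS]] := inner_dist_lipschitz_joined dist.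
  exists (fun s => t^-1 *: g s).
  have near_end v v' : `|v' - t *: v| <= e * t -> `|t^-1 *: v' - v| <= n.+1%:R^-1.
    move=> h; have -> : t^-1 *: v' - v = t^-1 *: (v' - t *: v).
      by rewrite scalerBr scalerA mulVf ?gt_eqF// scale1r.
    rewrite normrZ gtr0_norm ?invr_gt0// ler_pdivrMl// mulrC.
    exact: le_trans h (lt_e _ en).
  split.
  - move=> a b a01 b01; rewrite -scalerBr normrZ gtr0_norm ?invr_gt0//.
    rewrite ler_pdivrMl//; apply: le_trans (gl a b a01 b01) _.
    by rewrite le_eqVlt; apply/orP; left; apply/eqP; rewrite /Mx; ring.
  - by rewrite gx; exact: near_end.
  - by rewrite gy; exact: near_end.
  - exists t => // s s01; rewrite scalerA mulfV ?gt_eqF// scale1r.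
    by case: (gS s s01).
have ends (s : R) z : (forall n, `|f n s - z| <= n.+1%:R^-1) ->
    f n s @[n --> \oo] --> z.
  move=> fz; apply/cvgrPdist_le => e e0.
  apply: filterS (near_infty_natSinv_lt (PosNum e0)) => n /ltW ne.
  by rewrite distrC; exact: le_trans (fz n) ne.
have [|||g [g0 g1 gl gS]] := @lipschitz_path_limit R q f Mx x y.
- by move=> n; case: (Hf n).
- by apply: ends => n; case: (Hf n).
- by apply: ends => n; case: (Hf n).
exists g; split=> //.
- move=> s t s01 t01; apply: le_trans (gl s t s01 t01) _.
  by rewrite ler_wpM2r// /Mx ler_wpM2r// lerDl.
- move=> s s01 e M e0.
  have [n Mn fn] := gS s s01 e _ e0 (nbhs_infty_ger M).
  have [_ _ _ [t nt St]] := Hf n.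
  exists t; first exact: le_lt_trans nt.
  have t0 : 0 < t by apply: le_lt_trans nt.
  exists (t *: f n s); first exact: St.
  by rewrite -scalerBr normrZ gtr0_norm// mulrC ler_pM2r.
Qed.

End Cones.

(** * The tangent cone at infinity *)

Theorem corollary6p4 (R : realType) (D : o_minimal_structure R) (q : nat)
    (X : set 'rV[R]_q) (c : nat) (C : 'I_c -> set 'rV[R]_q)
    (closedX : closed X) (definableX : definable D X)
    (componentsX : germ_components_at_infinity X C)
    (C_LNE : forall i : 'I_c, locally_LNE_at_infinity (C i))
    (C_disjoint : forall i j : 'I_c, (i < j)%N ->
      asymptotic_set (C i) `&` asymptotic_set (C j) = set0) :
  LNE (nonneg_cone (asymptotic_set X)).
Proof.
have [R0 [r [[R00 _] R0r [CX _ Csurj]]]] := componentsX.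
have r0 : 0 <= r by rewrite ltW// (lt_le_trans R00).
have sub i x : C i x -> X x.
  by have [y _ <-] := CX i I => /connected_component_sub[].
have cover x : X x -> r <= enorm x -> exists i, C i x.
  move=> Xx rx; have Ex : end_part X r x by [].
  have [i _ Ci] := Csurj (connected_component (end_part X r) x)
    (ex_intro2 _ _ x Ex erefl).
  by exists i; rewrite Ci; exact: connected_component_refl.
set W := nonneg_cone _.
have WZ w (a : R) : W w -> 0 <= a -> W (a *: w).
  move=> [u Xu [b /= b0 <-]] a0; exists u => //.
  by exists (a * b); rewrite ?scalerA//=; exact: mulr_ge0.
have apart i j w : i != j -> tangent_at_infinity (C i) w ->
    tangent_at_infinity (C j) w -> w = 0.
  move=> ij Ti Tj; apply/eqP; apply: contraNT ij => w0; apply/eqP/val_inj/eqP.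
  have Ai := tangent_asymptotic w0 Ti; have Aj := tangent_asymptotic w0 Tj.
  have [ij|ji|//] := ltngtP i j.
    by have := C_disjoint _ _ ij; rewrite -subset0 => /(_ _ (conj Ai Aj)).
  by have := C_disjoint _ _ ji; rewrite -subset0 => /(_ _ (conj Aj Ai)).
have TW i x w : W x -> tangent_at_infinity (C i) w -> W w.
  move=> Wx Ti; have [->|w0] := eqVneq w 0.
    by rewrite -[0](scale0r x); exact: WZ.
  apply/(asymptotic_cone_tangent X w0) => e M e0.
  have [t Mt [z Cz zt]] := Ti e M e0.
  by exists t => //; exists z => //; exact: sub Cz.
(* Uniqueness of the component to which [x] is tangent gives tracking. *)
have component x : x != 0 -> W x -> exists2 i, tangent_at_infinity (C i) x &
    tracked_at_infinity (C i) x.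
  move=> x0 Wx; have TX := (asymptotic_cone_tangent X x0).1 Wx.
  have [i Ti] := tangent_of_component r0 cover x0 TX.
  exists i => //; apply: (tracked_by_component r0 cover x0).
    exact: definable_tangent_tracked definableX TX.
  by move=> j ji Tj; move: x0; rewrite (apart _ _ _ ji Tj Ti) eqxx.
have pair (ij : 'I_c * 'I_c) : exists k : R, 0 <= k /\
    forall x y, W x -> W y -> x != 0 -> y != 0 -> x != y ->
      tangent_at_infinity (C ij.1) x -> tracked_at_infinity (C ij.1) x ->
      tangent_at_infinity (C ij.2) y -> tracked_at_infinity (C ij.2) y ->
      exists2 M, M <= k * `|x - y| & 0 <= M /\ lipschitz_joined W x y M.
  case: ij => i j /=; have [<-{j}|ij] := eqVneq i j.
    have [k k0 Hk] := LNE_at_infinity_joined (C_LNE i).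
    exists k; split=> [|x y Wx Wy x0 y0 xy Tx tx Ty ty]; first exact: ltW.
    exists (k * `|x - y|) => //; split; first by rewrite mulr_ge0// ltW.
    have [f [f0 f1 fl fT]] := Hk x y x0 y0 xy tx ty.
    by exists f; split=> // s s01; exact: TW Wx (fT s s01).
  have [d d0 Hd] := tangent_cones_apart (fun w => @apart i j w ij).
  exists (2 / d); split=> [|x y Wx Wy x0 y0 xy Tx tx Ty ty].
    by rewrite divr_ge0// ltW.
  exists (2 * (`|x| + `|y|)).
    by rewrite -mulrA ler_pM2l// ler_pdivlMl// Hd.
  split; last exact: lipschitz_joined_via_apex.
  by rewrite mulr_ge0// addr_ge0.
have /choice[k Hk] := pair.
(* A constant for all pairs of components at once; [2] serves the paths to and
   from the apex. *)
pose N := \sum_ij k ij + 2.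
have N0 : 0 <= N.
  by rewrite addr_ge0// sumr_ge0// => ij _; case: (Hk ij).
exists (q%:R * N + 1) => [|x y Wx Wy]; first by rewrite ltr_wpDl// mulr_ge0.
suff [M MN [M0 joined]] : exists2 M, M <= N * `|x - y| &
    0 <= M /\ lipschitz_joined W x y M.
  apply: le_trans (lipschitz_joined_inner_dist M0 joined) _; rewrite lee_fin.
  apply: (@le_trans _ _ (q%:R * N * enorm (x - y))).
    rewrite -mulrA ler_wpM2l//; apply: le_trans MN _.
    by rewrite ler_wpM2l// norm_le_enorm.
  by rewrite ler_wpM2r ?lerDl// (le_trans _ (norm_le_enorm _)).
have sum0 : 0 <= \sum_ij k ij by apply: sumr_ge0 => ij _; case: (Hk ij).
(* When one end is the apex, [`|x| + `|y|] is the distance itself. *)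
have apex : `|x - y| = `|x| + `|y| -> exists2 M, M <= N * `|x - y| &
    0 <= M /\ lipschitz_joined W x y M.
  move=> xyE; exists (2 * (`|x| + `|y|)).
    by rewrite xyE ler_wpM2r ?addr_ge0// lerDr.
  split; first by rewrite mulr_ge0// addr_ge0.
  exact: lipschitz_joined_via_apex.
have [x0|x0] := eqVneq x 0.
  by apply: apex; rewrite x0 sub0r normrN normr0 add0r.
have [y0|y0] := eqVneq y 0.
  by apply: apex; rewrite y0 subr0 normr0 addr0.
have [xy|xy] := eqVneq x y.
  exists 0; first by rewrite xy subrr normr0 mulr0.
  split=> //; exists (fun=> x); split=> // s t _ _.
  by rewrite subrr normr0 mul0r.
have [i Ti ti] := component x x0 Wx; have [j Tj tj] := component y y0 Wy.
have [kij0 /(_ x y Wx Wy x0 y0 xy Ti ti Tj tj)[M Mk HM]] := Hk (i, j).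
exists M => //; apply: le_trans Mk _; rewrite ler_wpM2r//.
rewrite /N (bigD1 (i, j))//= -addrA lerDl addr_ge0// sumr_ge0// => p _.
by case: (Hk p).
Qed.
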